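(* Let $L_\ell$ be the closed line segment of length $\ell$ (i.e. a closed interval $[a,b]\subset\mathbb{R}$ with $b-a=\ell$ and the usual metric), let $\mu$ be Lebesgue measure on $L_\ell$, and let $\delta_a$ and $\delta_b$ be the Dirac delta measures supported at the two respective end points. Then a weight measure on $L_\ell$ is given by $\tfrac12(\delta_a+\delta_b+\mu)$. Hence the magnitude is $$|L_\ell|=1+\ell/2.$$
   Context: A weight measure on a metric space $(X,d)$ is a finite signed Borel measure $\nu$ on $X$ such that $\int_{x\in X}e^{-d(x,y)}\,d\nu(x)=1$ for all $y\in X$. If a weight measure $\nu$ exists on $X$, the magnitude of $X$ is defined to be its total mass $|X|:=\nu(X)$ (which does not depend on the choice of weight measure). *)

(* Defs.v *)
From HB Require Import structures.
From mathcomp Require Import all_boot all_order all_algebra.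
From mathcomp Require Import all_classical all_reals all_analysis.

Set Implicit Arguments.
Unset Strict Implicit.
Unset Printing Implicit Defensive.

Import Order.TTheory GRing.Theory Num.Theory.
Import numFieldNormedType.Exports.

Local Open Scope classical_set_scope.
Local Open Scope ring_scope.

(* [measurableType] extends [pointedType], hence the point: the metric spaces
   below are the nonempty ones. *)
#[short(type="pmetricType")]
HB.structure Definition PointedMetric (K : numDomainType) :=
  { M of Metric K M & isPointed M }.

Definition borel (R : realType) (X : pmetricType R) :=
  g_sigma_algebraType (@open X).

(* The integral against a signed measure, through its Jordan decomposition; by
   [Hahn_decomposition_uniq] the choice of Hahn decomposition is immaterial. *)
Definition charge_integral d (T : measurableType d) (R : realType)
    (nu : {charge set T -> \bar R}) (f : T -> \bar R) : \bar R :=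
  let hP := cid (Hahn_decomposition nu) in
  let hN := cid (svalP hP) in
  (\int[jordan_pos (svalP hN)]_x f x - \int[jordan_neg (svalP hN)]_x f x)%E.

(* A [charge] takes finite values on measurable sets. *)
Definition weight_measure (R : realType) (X : pmetricType R)
    (nu : {charge set (borel X) -> \bar R}) : Prop :=
  forall y : X,
    charge_integral nu (fun x => (expR (- mdist (x : X) y))%:E) = 1%E.

(* All weight measures on X have the same total mass; the value is
   unspecified if X carries no weight measure. *)
Definition magnitude (R : realType) (X : pmetricType R) : R :=
  get [set fine (nu setT) | nu in @weight_measure R X].

(* The proof of a <= b is a parameter of the type because it provides the
   distinguished point. *)
Definition segment (R : realType) (a b : R) (ab : a <= b) : Type :=
  set_type `[a, b].

Section segment.
Context (R : realType) (a b : R) (ab : a <= b).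
Local Notation L := (segment ab).

Lemma left_in_segment : a \in `[a, b]%classic.
Proof. by rewrite inE /= in_itv /= lexx. Qed.

Lemma right_in_segment : b \in `[a, b]%classic.
Proof. by rewrite inE /= in_itv /= lexx andbT. Qed.

Definition segment_left : L := exist _ a left_in_segment.
Definition segment_right : L := exist _ b right_in_segment.

HB.instance Definition _ := PseudoMetric.copy L (set_type `[a, b]).
HB.instance Definition _ := isPointed.Build L segment_left.

Definition segment_val (x : L) : R := sval x.

Definition segment_dist (x y : L) : R := `|segment_val x - segment_val y|.

Lemma segment_dist_ge0 x y : 0 <= segment_dist x y.
Proof. exact: normr_ge0. Qed.

Lemma segment_val_inj : injective segment_val.
Proof. exact: val_inj. Qed.

Lemma segment_dist_positivity x y : segment_dist x y = 0 -> x = y.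
Proof. by move/normr0_eq0/eqP; rewrite subr_eq0 => /eqP/segment_val_inj. Qed.

Lemma segment_ballE (x : L) (d : R) :
  ball x d = [set y | segment_dist x y < d].
Proof. by []. Qed.

HB.instance Definition _ := @PseudoMetric_isMetric.Build R L segment_dist
  segment_dist_ge0 segment_dist_positivity segment_ballE.

Lemma measurable_image_segment_val (A : set (borel L)) :
  measurable A -> measurable (segment_val @` A).
Proof.
have mI : measurable (`[a, b]%classic : set R) by exact: measurable_itv.
have valI (x : L) : `[a, b]%classic (segment_val x).
  by case: x => x /= /set_mem.
have imC (B : set (borel L)) :
    segment_val @` ([set: L] `\` B) = `[a, b]%classic `\` segment_val @` B.
  apply/seteqP; split=> [_ [x [_ nBx] <-]|x [abx nBx]].
    by split; [exact: valI|case=> y By /segment_val_inj yx; rewrite -yx in nBx].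
  exists (exist _ x (mem_set abx)) => //; split=> // Bx; apply: nBx.
  by exists (exist _ x (mem_set abx)).
have imV (U : set R) : segment_val @` (segment_val @^-1` U) = U `&` `[a, b].
  apply/seteqP; split=> [_ [x Ux <-]|x [Ux abx]].
    by split; [exact: Ux|exact: valI].
  by exists (exist _ x (mem_set abx)).
move: A; apply: smallest_sub => [|_ [U oU <-]] /=; last first.
  by rewrite imV; apply: measurableI mI; exact: measurable_realfun.open_measurable.
split=> /= [|B mB|F mF].
- by rewrite image_set0; exact: measurable0.
- by rewrite imC; exact: measurableD.
- by rewrite image_bigcup; exact: bigcupT_measurable.
Qed.

Definition segment_lebesgue (A : set (borel L)) : \bar R :=
  lebesgue_measure (segment_val @` A).

Let segment_lebesgue0 : segment_lebesgue set0 = 0%E.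
Proof. by rewrite /segment_lebesgue image_set0 measure0. Qed.

Let segment_lebesgue_ge0 A : (0 <= segment_lebesgue A)%E.
Proof. exact: measure_ge0. Qed.

Let segment_lebesgue_sigma_additive : semi_sigma_additive segment_lebesgue.
Proof.
move=> F mF tF mUF; rewrite /segment_lebesgue image_bigcup.
apply: measure_semi_sigma_additive.
- by move=> i; exact: measurable_image_segment_val.
- move=> i j _ _ [_ [[x Fix <-] [y Fjy /segment_val_inj yx]]].
  by apply: tF => //; exists x; split=> //; rewrite -yx.
- by rewrite -image_bigcup; exact: measurable_image_segment_val.
Qed.

HB.instance Definition _ := isMeasure.Build _ _ _ segment_lebesgue
  segment_lebesgue0 segment_lebesgue_ge0 segment_lebesgue_sigma_additive.

Let segment_lebesgue_fin : fin_num_fun segment_lebesgue.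
Proof.
move=> A mA; rewrite ge0_fin_numE//.
have : (lebesgue_measure (segment_val @` A) <=
        lebesgue_measure (`[a, b]%classic : set R))%E.
  apply: le_measure; rewrite ?inE.
  - exact: measurable_image_segment_val.
  - exact: measurable_itv.
  - by move=> _ [[x /= /set_mem abx] _ <-].
move/le_lt_trans; apply.
by rewrite lebesgue_measure_itv /=; case: ifPn => _; exact: ltry.
Qed.

HB.instance Definition _ := Measure_isFinite.Build _ _ _ segment_lebesgue
  segment_lebesgue_fin.

End segment.

Arguments segment_lebesgue {R a b} ab A.

(* Main.v *)
Require Import Defs.
From mathcomp Require Import all_boot all_order all_algebra.
From mathcomp Require Import all_classical all_reals all_analysis.
From mathcomp Require Import measurable_realfun ring.

Set Implicit Arguments.
Unset Strict Implicit.
Unset Printing Implicit Defensive.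

Import Order.TTheory GRing.Theory Num.Theory.
Import numFieldNormedType.Exports.

Local Open Scope classical_set_scope.
Local Open Scope ring_scope.

(** Write K(x, y) = exp(- d(x, y)) for the similarity kernel and call a signed
measure nu a weight if the integral of K(x, y) in x against nu is 1 for every
y.

The stated measure is a weight by calculus: if a <= y <= b, the integral of
exp(- |x - y|) over [a, b] splits at y into
(1 - exp(a - y)) + (1 - exp(y - b)), and the two Dirac masses contribute exactly
the missing exp(a - y) + exp(y - b), so the total is 2 and the factor 1/2
normalizes it (integral_exp_dist, weight_measure_segment). The measure is
nonnegative, so integrating against it as a signed measure is ordinary
integration (charge_integral_measure), and the Lebesgue part is transported
from the segment to the real line by the inclusion map
(integral_segment_lebesgue).

This measure determines the magnitude because all weights have the same mass
(weight_measure_mass_unique): for weights nu and nu', Fubini and the symmetry of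
K give
  nu(X) = int (int K(x, y) dnu'(y)) dnu(x)
        = int (int K(x, y) dnu(x)) dnu'(y) = nu'(X).
It remains to read off the mass (1 + 1 + (b - a)) / 2. *)

(** * Integration against a signed measure that is nonnegative *)

(** The negative part of a Hahn decomposition carries no mass here: on it the
signed measure is nonpositive, and m is nonnegative. So the Jordan
decomposition is (m, 0). *)
Lemma charge_integral_measure d (T : measurableType d) (R : realType)
    (nu : {charge set T -> \bar R}) (m : {measure set T -> \bar R})
    (f : T -> \bar R) :
  (forall A, measurable A -> nu A = m A) ->
  charge_integral nu f = (\int[m]_x f x)%E.
Proof.
move=> num; rewrite /charge_integral.
set hP := cid (Hahn_decomposition nu).
case: (cid (svalP hP)) => N nuPN /=.
have neg0 A : measurable A -> jordan_neg nuPN A = 0%E.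
  move=> mA; have [_ [mN neg] _ _] := nuPN.
  have mAN : measurable (A `&` N) by exact: measurableI.
  apply/eqP; rewrite eq_le measure_ge0 andbT jordan_negE charge.cjordan_negE.
  by rewrite /crestr0 mem_set// /crestr leeNl oppe0 num.
have posm A : measurable A -> jordan_pos nuPN A = m A.
  move=> mA; rewrite -num// (jordan_decomp nuPN mA) /cadd/= cscaleN1.
  by rewrite [X in (_ - X)%E](neg0 _ mA) sube0.
rewrite -[RHS]sube0 -(integral_measure_zero setT f); congr (_ - _)%E.
- by apply: eq_measure_integral => A mA _; exact: posm.
- by apply: eq_measure_integral => A mA _; exact: neg0.
Qed.

(** * Uniqueness of the mass of a weight measure *)

Section mass.
Context (R : realType) (X : pmetricType R).
Local Open Scope ereal_scope.

Let K (z : borel X * borel X) : \bar R :=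
  (expR (- mdist (z.1 : X) (z.2 : X)))%:E.

Let K_ge0 z : 0 <= K z. Proof. by rewrite lee_fin expR_ge0. Qed.

(** Fubini needs measurability for the product of the two Borel sigma-algebras,
which continuity of the distance need not give when X is not separable: the
Borel sigma-algebra of the product space can then be strictly larger. *)
Context (mK : measurable_fun [set: borel X * borel X] K).

Let pairing (p q : {finite_measure set (borel X) -> \bar R}) : \bar R :=
  \int[p]_x \int[q]_y K (x, y).

(** The kernel is at most 1, so the inner integral is bounded by the mass of
q. *)
Let pairing_integrable (p q : {finite_measure set (borel X) -> \bar R}) :
  p.-integrable setT (fun x => \int[q]_y K (x, y)).
Proof.
have mq : measurable_fun [set: borel X] (fun x => \int[q]_y K (x, y)).
  exact: (measurable_fun_fubini_tonelli_F K).
apply/integrableP; split => //.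
apply: (@le_lt_trans _ _ (\int[p]_x (cst (q setT)) x)).
  apply: ge0_le_integral => //; first exact: measurableT_comp.
  move=> x _; rewrite gee0_abs ?integral_ge0//.
  rewrite -[leRHS]mul1e -integral_cst//.
  apply: ge0_le_integral => //; first exact: (measurable_fun_pair2 _ mK).
  by move=> y _; rewrite lee_fin -expR0 ler_expR oppr_le0 mdist_ge0.
by rewrite integral_cst// -ge0_fin_numE ?mule_ge0// fin_numM// fin_num_measure.
Qed.

Let pairing_fin_num p q : pairing p q \is a fin_num.
Proof. by apply: integrable_fin_num => //; exact: pairing_integrable. Qed.

Let pairingC p q : pairing p q = pairing q p.
Proof.
rewrite /pairing (fubini_tonelli _ mK K_ge0).
apply: eq_integral => y _; apply: eq_integral => x _.
by rewrite /K /= metric_sym.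
Qed.

(** The measures q1 and q2 are the Jordan parts of nu: the second conclusion is
the weight equation integrated against p, which replaces the constant 1 by the
mass of p. *)
Let mass_pairing (nu : {charge set (borel X) -> \bar R}) :
  weight_measure nu ->
  exists q1 q2 : {finite_measure set (borel X) -> \bar R},
    nu setT = q1 setT - q2 setT /\
    forall p : {finite_measure set (borel X) -> \bar R},
      p setT = pairing p q1 - pairing p q2.
Proof.
rewrite /weight_measure /charge_integral.
set hP := cid (Hahn_decomposition nu); set hN := cid (svalP hP) => nu1.
exists (jordan_pos (svalP hN)), (jordan_neg (svalP hN)); split=> [|p].
  by rewrite (jordan_decomp (svalP hN) measurableT) /cadd/= cscaleN1.
rewrite /pairing -integralB; [|by []|exact: pairing_integrable..].
transitivity (\int[p]_x (1 : \bar R)); first by rewrite integral_cst// mul1e.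
apply: eq_integral => x _; rewrite -[LHS](nu1 x).
suff -> : (fun y => K (x, y)) =
          (fun y : borel X => (expR (- mdist (y : X) x))%:E) by [].
by apply/funext => y; rewrite /K /= metric_sym.
Qed.

(** Expanding the two masses over the Jordan parts of nu and nu' gives the same
four pairings, which are finite, hence can be rearranged freely. *)
Lemma weight_measure_mass_unique (nu nu' : {charge set (borel X) -> \bar R}) :
  weight_measure nu -> weight_measure nu' -> nu setT = nu' setT.
Proof.
move=> /mass_pairing[q1 [q2 [-> qB]]] /mass_pairing[p1 [p2 [-> pB]]].
rewrite (pB q1) (pB q2) (qB p1) (qB p2).
rewrite (pairingC p1 q1) (pairingC p1 q2) (pairingC p2 q1) (pairingC p2 q2).
have pairingE p q : exists r : R, pairing p q = r%:E.
  by exists (fine (pairing p q)); rewrite fineK.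
have [r11 ->] := pairingE q1 p1; have [r12 ->] := pairingE q1 p2.
have [r21 ->] := pairingE q2 p1; have [r22 ->] := pairingE q2 p2.
by rewrite -!EFinB; congr EFin; ring.
Qed.

End mass.

(** * Transport from the segment to the real line *)

Section segment.
Context (R : realType) (a b : R) (ab : a <= b).
Local Notation L := (segment ab).

Lemma measurable_segment_val :
  measurable_fun [set: borel L]
    (@segment_val R a b ab : borel L -> measurableTypeR R).
Proof.
apply: (measurability _ (RGenOpens.measurableE R)) => _ [_ [c [d ->] <-]].
rewrite setTI; apply: sub_sigma_algebra.
by exists `]c, d[%classic => //; exact: interval_open.
Qed.

Lemma measurable_segment_kernel :
  measurable_fun [set: borel L * borel L]
    (fun z => (expR (- mdist (z.1 : L) (z.2 : L)))%:E).
Proof.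
apply/measurable_EFinP; apply: measurableT_comp => //.
apply: measurableT_comp => //; apply: measurableT_comp => //.
apply: measurable_funB.
  exact: (measurableT_comp measurable_segment_val).
exact: (measurableT_comp measurable_segment_val).
Qed.

(** The image of the measure of the segment under the inclusion agrees with
Lebesgue measure on the measurable subsets of [a, b]. *)
Lemma integral_segment_lebesgue (f : R -> \bar R) :
  measurable_fun setT f -> (forall x, 0 <= f x)%E ->
  (\int[segment_lebesgue ab]_x f (segment_val (x : L)) =
   \int[lebesgue_measure]_(x in `[a, b]) f x)%E.
Proof.
move=> mf f0.
have valI (x : L) : `[a, b]%classic (segment_val x).
  by case: x => x /= /set_mem.
have mI : measurable (`[a, b]%classic : set R) by exact: measurable_itv.
have pE : (@segment_val R a b ab) @^-1` `[a, b]%classic = setT.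
  by apply/seteqP; split => // x _; exact: valI.
transitivity (\int[pushforward (segment_lebesgue ab)
    (@segment_val R a b ab : borel L -> measurableTypeR R)]_(x in `[a, b])
    f x)%E.
  rewrite (ge0_integral_pushforward measurable_segment_val)//; first last.
    exact: measurable_funTS.
  by rewrite pE.
apply: eq_measure_integral => [|mval A mA AI].
  exact: measurable_segment_val.
suff imV : (@segment_val R a b ab) @` ((@segment_val R a b ab) @^-1` A) = A.
  by rewrite -[in RHS]imV.
apply/seteqP; split=> [_ [x Ax <-] //|x Ax].
by exists (exist _ x (mem_set (AI _ Ax))).
Qed.

End segment.

(** * The integral of the exponential kernel over an interval *)

Lemma integral_itv_primitive (R : realType) (f F : R -> R) (a b : R) :
  a <= b -> continuous f -> (forall x : R, is_derive x 1 F (f x)) ->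
  (\int[lebesgue_measure]_(x in `[a, b]) (f x)%:E = (F b - F a)%:E)%E.
Proof.
rewrite le_eqVlt => /predU1P[<- _ _|ltab cf dF].
  by rewrite set_itv1 integral_set1 subrr.
have cF x : F y @[y --> x] --> F x.
  by apply: differentiable_continuous; apply/derivable1_diffP; case: (dF x).
rewrite (continuous_FTC2 ltab (F := F)) ?EFinB//.
- by apply: continuous_subspaceT => x; exact: cf.
- split=> [x _||].
  + by case: (dF x).
  + exact: cvg_at_right_filter.
  + exact: cvg_at_left_filter.
- by move=> x _; rewrite derive1E; case: (dF x).
Qed.

(** Splitting at y removes the absolute value; on each half the integrand is its
own primitive up to sign. *)
Lemma integral_exp_dist (R : realType) (a b y : R) : a <= y -> y <= b ->
  (\int[lebesgue_measure]_(x in `[a, b]) (expR (- `|x - y|))%:E =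
   (2 - expR (a - y) - expR (y - b))%:E)%E.
Proof.
move=> ay yb.
have mE : measurable_fun setT (fun x : R => (expR (- `|x - y|))%:E).
  apply/measurable_EFinP; do 3!apply: measurableT_comp => //.
  exact: measurable_funB.
rewrite (@itv_bndbnd_setU _ _ _ (BRight y))//.
rewrite ge0_integral_setU//=; last 2 first.
- exact: measurable_funTS.
- rewrite disj_set2E; apply/eqP/seteqP; split=> // x /=.
  by rewrite !in_itv/= => -[/andP[_ xy] /andP[]]; rewrite ltNge xy.
rewrite integral_itv_obnd_cbnd; last exact: measurable_funTS.
have -> : (\int[lebesgue_measure]_(x in `[a, y]) (expR (- `|x - y|))%:E =
    \int[lebesgue_measure]_(x in `[a, y]) (expR (x - y))%:E)%E.
  apply: eq_integral => x; rewrite inE/= in_itv/= => /andP[_ xy].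
  by rewrite ler0_norm ?opprK// subr_le0.
have -> : (\int[lebesgue_measure]_(x in `[y, b]) (expR (- `|x - y|))%:E =
    \int[lebesgue_measure]_(x in `[y, b]) (expR (y - x))%:E)%E.
  apply: eq_integral => x; rewrite inE/= in_itv/= => /andP[yx _].
  by rewrite ger0_norm ?opprB// subr_ge0.
have contexp (g : R -> R) : continuous g -> continuous (fun x => expR (g x)).
  by move=> cg x; apply: continuous_comp; [exact: cg|exact: continuous_expR].
have -> : (\int[lebesgue_measure]_(x in `[a, y]) (expR (x - y))%:E =
    (expR (y - y) - expR (a - y))%:E)%E.
  apply: (integral_itv_primitive (F := fun x => expR (x - y))) => // [|x].
    by apply: contexp => x; apply: cvgB => //; exact: cvg_cst.
  by apply: is_derive_eq; ring.
have -> : (\int[lebesgue_measure]_(x in `[y, b]) (expR (y - x))%:E =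
    (- expR (y - b) - - expR (y - y))%:E)%E.
  apply: (integral_itv_primitive (F := fun x => - expR (y - x))) => // [|x].
    by apply: contexp => x; apply: cvgB => //; exact: cvg_cst.
  by apply: is_derive_eq; ring.
rewrite -EFinD; congr EFin; rewrite !subrr expR0; by ring.
Qed.

(** * The weight measure of a segment *)

Section segment_weight.
Context (R : realType) (a b : R) (ab : a <= b).
Local Notation L := (segment ab).
Let delta_a :=
  charge_of_finite_measure (R := R) (\d_(segment_left ab : borel L)).
Let delta_b :=
  charge_of_finite_measure (R := R) (\d_(segment_right ab : borel L)).
Let mu := charge_of_finite_measure (segment_lebesgue ab).

Lemma weight_measure_segment :
  weight_measure (X := L) (cscale 2^-1 (cadd (cadd delta_a delta_b) mu)).
Proof.
have h0 : 0 <= 2^-1 :> R by rewrite invr_ge0.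
move=> y; rewrite (charge_integral_measure
  (m := mscale (NngNum h0) (measure_add (measure_add
    (\d_(segment_left ab : borel L)) (\d_(segment_right ab : borel L)))
    (segment_lebesgue ab)))); last first.
  move=> A _; congr (_ * _)%E; rewrite [RHS]measure_addE; congr (_ + _)%E.
  by rewrite [RHS]measure_addE.
have mKy : measurable_fun [set: borel L]
    (fun x : borel L => (expR (- mdist (x : L) y))%:E).
  exact: (measurable_fun_pair1 (y : borel L)
            (@measurable_segment_kernel _ _ _ ab)).
have Ky0 x : (0 <= (expR (- mdist (x : L) y))%:E)%E.
  by rewrite lee_fin expR_ge0.
rewrite ge0_integral_mscale// ge0_integral_measure_add//.
rewrite ge0_integral_measure_add// !integral_dirac// !diracT !mul1e.
rewrite (integral_segment_lebesgue ab
  (f := fun x => (expR (- `|x - segment_val y|))%:E)); last 2 first.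
- apply/measurable_EFinP; do 3!apply: measurableT_comp => //.
  exact: measurable_funB.
- by move=> x; rewrite lee_fin expR_ge0.
have /andP[ay yb] : a <= segment_val y <= b.
  by have := set_mem (svalP y); rewrite /= in_itv.
rewrite integral_exp_dist// /mdist/= /segment_dist/=.
rewrite ler0_norm ?subr_le0// ger0_norm ?subr_ge0// opprK opprB.
rewrite -!EFinD -EFinM; congr EFin; by field.
Qed.

Lemma mass_segment :
  cscale 2^-1 (cadd (cadd delta_a delta_b) mu) setT = (1 + (b - a) / 2)%:E.
Proof.
have imT : (@segment_val R a b ab) @` setT = `[a, b]%classic.
  apply/seteqP; split=> [_ [[x /= /set_mem abx] _ <-] //|x abx].
  by exists (exist _ x (mem_set abx)).
have leb : segment_lebesgue ab setT = (b - a)%:E.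
  rewrite /segment_lebesgue imT lebesgue_measure_itv/= lte_fin.
  move: ab; rewrite le_eqVlt => /predU1P[->|->]; last by rewrite EFinB.
  by rewrite ltxx subrr.
have da : delta_a setT = 1%E by exact: diracT.
have db : delta_b setT = 1%E by exact: diracT.
transitivity ((2^-1)%:E * (delta_a setT + delta_b setT + mu setT))%E => //.
by rewrite da db [mu _]leb -!EFinD -EFinM; congr EFin; field.
Qed.

End segment_weight.

Theorem theorem2 (R : realType) (a b l : R) (ab : a <= b) (hl : b - a = l) :
  let L := segment ab in
  let delta_a := charge_of_finite_measure (\d_(segment_left ab : borel L)) in
  let delta_b := charge_of_finite_measure (\d_(segment_right ab : borel L)) in
  let mu := charge_of_finite_measure (segment_lebesgue ab) in
  weight_measure (X := L) (cscale 2^-1 (cadd (cadd delta_a delta_b) mu)) /\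
  magnitude L = 1 + l / 2.
Proof.
move=> L delta_a delta_b mu; have wL := @weight_measure_segment R a b ab.
split; first exact: wL.
rewrite -hl; apply: get_unique.
  by eexists; [exact: wL|exact: (congr1 fine (mass_segment ab))].
move=> _ [nu wnu <-].
have mK := @measurable_segment_kernel R a b ab.
by rewrite (weight_measure_mass_unique mK wnu wL) [X in fine X](mass_segment ab).
Qed.
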